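(* Let $\mathfrak{L}$ be a left Leibniz algebra over a field $\mathbb{F}$, and let $M$ and $N$ be $\mathfrak{L}$-bimodules. Then the following statements hold (equalities of quotients of $M\otimes N$): (a) If $M$ and $N$ are symmetric, then $M\,\overline{\otimes}\,N=M\,\underline{\otimes}\,N=M\otimes N$. (b) If $M$ and $N$ are anti-symmetric, then $M\,\overline{\otimes}\,N=M\,\underline{\otimes}\,N=M\otimes N$. (c) If $M$ is symmetric and $N$ is anti-symmetric, then $M\,\overline{\otimes}\,N=M\,\underline{\otimes}\,N=(M\otimes N)/(\mathfrak{L}M\otimes\mathfrak{L}N)$. (d) If $M$ is anti-symmetric and $N$ is symmetric, then $M\,\overline{\otimes}\,N=M\,\underline{\otimes}\,N=(M\otimes N)/(\mathfrak{L}M\otimes\mathfrak{L}N)$.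
   Context: A left Leibniz algebra is an $\mathbb{F}$-vector space $\mathfrak{L}$ with a bilinear multiplication satisfying $x(yz)=(xy)z+y(xz)$. An $\mathfrak{L}$-bimodule is an $\mathbb{F}$-vector space $M$ with bilinear left and right $\mathfrak{L}$-actions satisfying, for all $x,y\in\mathfrak{L}$, $m\in M$: (LLM) $(xy)\cdot m=x\cdot(y\cdot m)-y\cdot(x\cdot m)$; (LML) $(x\cdot m)\cdot y=x\cdot(m\cdot y)-m\cdot(xy)$; (MLL) $(m\cdot x)\cdot y=m\cdot(xy)-x\cdot(m\cdot y)$. It is symmetric if $m\cdot x=-x\cdot m$ for all $x,m$, and anti-symmetric if $m\cdot x=0$ for all $x,m$. For $\mathfrak{L}$-bimodules $M,N$, the space $M\otimes N$ (over $\mathbb{F}$) carries the actions $x\cdot(m\otimes n):=(x\cdot m)\otimes n+m\otimes(x\cdot n)$ and $(m\otimes n)\cdot x:=(m\cdot x)\otimes n+m\otimes(n\cdot x)$. Let $T(M,N)$ be the smallest subspace of $M\otimes N$ that is closed under these left and right actions and contains $$S(M,N):=\{(x\cdot m+m\cdot x)\otimes(n\cdot y)+(m\cdot y)\otimes(x\cdot n+n\cdot x)\mid x,y\in\mathfrak{L},\ m\in M,\ n\in N\}.$$ Put $M_0:=\langle x\cdot m+m\cdot x\mid x\in\mathfrak{L},m\in M\rangle_{\mathbb{F}}$, $M\mathfrak{L}:=\langle m\cdot x\mid m\in M,x\in\mathfrak{L}\rangle_{\mathbb{F}}$, $\mathfrak{L}M:=\langle x\cdot m\mid x\in\mathfrak{L},m\in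 M\rangle_{\mathbb{F}}$ (similarly for $N$), and $T_0(M,N):=M_0\otimes N\mathfrak{L}+M\mathfrak{L}\otimes N_0\subseteq M\otimes N$. Define $M\,\overline{\otimes}\,N:=(M\otimes N)/T(M,N)$ and $M\,\underline{\otimes}\,N:=(M\otimes N)/T_0(M,N)$, with the induced actions. *)

(* Defs.v *)
From HB Require Import structures.
From mathcomp Require Import all_boot all_algebra generic_quotient ring_quotient.
From mathcomp Require Import sesquilinear boolp classical_sets.
From mathcomp Require Import freeg.

Set Implicit Arguments.
Unset Strict Implicit.
Unset Printing Implicit Defensive.

Import GRing.Theory.
Local Open Scope ring_scope.
Local Open Scope quotient_scope.
Local Open Scope classical_set_scope.

Notation is_bilinear f := (bilinear_for *:%R *:%R f).

HB.mixin Record isLeibniz (F : fieldType) L of GRing.Lmodule F L := {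
  lmul : L -> L -> L;
  lmul_bilinear : is_bilinear lmul;
  lmulA : forall x y z, lmul x (lmul y z) = lmul (lmul x y) z + lmul y (lmul x z)
}.

#[short(type="leibnizType")]
HB.structure Definition Leibniz (F : fieldType) :=
  {L of isLeibniz F L & GRing.Lmodule F L}.

(* A vector space with a left and a right action of L, with no compatibility
   axiom: the tensor product of two bimodules need not satisfy (MLL), so it is
   in general only such an object. *)
HB.mixin Record hasBiaction (F : fieldType) (L : leibnizType F) M
    of GRing.Lmodule F M := {
  lact : L -> M -> M;
  ract : M -> L -> M;
  lact_bilinear : is_bilinear lact;
  ract_bilinear : is_bilinear ract
}.

#[short(type="biactType")]
HB.structure Definition Biact (F : fieldType) (L : leibnizType F) :=
  {M of hasBiaction F L M & GRing.Lmodule F M}.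

HB.mixin Record isLeibnizBimodule (F : fieldType) (L : leibnizType F) M
    of Biact F L M := {
  LLM : forall (x y : L) (m : M),
    lact (lmul x y) m = lact x (lact y m) - lact y (lact x m);
  LML : forall (x y : L) (m : M),
    ract (lact x m) y = lact x (ract m y) - ract m (lmul x y);
  MLL : forall (x y : L) (m : M),
    ract (ract m x) y = ract m (lmul x y) - lact x (ract m y)
}.

#[short(type="bimodType")]
HB.structure Definition Bimod (F : fieldType) (L : leibnizType F) :=
  {M of isLeibnizBimodule F L M & Biact F L M}.

Definition symmetric_bimod (F : fieldType) (L : leibnizType F) (M : bimodType L) :=
  forall (x : L) (m : M), ract m x = - lact x m.

Definition antisymmetric_bimod (F : fieldType) (L : leibnizType F)
    (M : bimodType L) :=
  forall (x : L) (m : M), ract m x = 0.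

Section Subspaces.
Variables (F : fieldType) (V : lmodType F).

Definition subspace (A : set V) : Prop := submod_closed (mem A).

Definition linspan (G : set V) : set V := smallest subspace G.

Definition sum_subspace (A B : set V) : set V := [set u + v | u in A & v in B].

Lemma subspaceP (A : set V) :
  subspace A <-> A 0 /\ forall a u v, A u -> A v -> A (a *: u + v).
Proof.
split=> -[A0 Alin]; split.
- by move: A0; rewrite !inE.
- by move=> a u v /mem_set Au /mem_set Av; apply/set_mem/Alin.
- exact/mem_set.
- by move=> a u v /set_mem Au /set_mem Av; apply/mem_set/Alin.
Qed.

Lemma linspan_subspace (G : set V) : subspace (linspan G).
Proof.
apply/subspaceP; split=> [A [/subspaceP[]] //|a u v Gu Gv A AG].
by have [/subspaceP[_ Alin] _] := AG; apply: Alin; [apply: Gu|apply: Gv].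
Qed.

Lemma sum_subspace_subspace (A B : set V) :
  subspace A -> subspace B -> subspace (sum_subspace A B).
Proof.
move=> /subspaceP[A0 Al] /subspaceP[B0 Bl]; apply/subspaceP; split.
  by exists 0 => //; exists 0 => //; rewrite addr0.
move=> a _ _ [u Au [v Bv <-]] [u' Au' [v' Bv' <-]].
exists (a *: u + u'); first exact: Al.
by exists (a *: v + v'); [apply: Bl|rewrite scalerDr addrACA].
Qed.

End Subspaces.

Section QuotientSpace.
Variables (F : fieldType) (V : lmodType F) (A : set V) (sA : subspace A).

(* The membership predicate of A, keyed by the proof that A is a subspace. *)
Definition subspace_pred of subspace A : {pred V} := mem A.
Local Notation I := (subspace_pred sA).

HB.instance Definition _ := GRing.isZmodClosed.Build V I (GRing.submod_closedB sA).

Definition qspace := {ideal_quot I}.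
HB.instance Definition _ := EqQuotient.on qspace.
HB.instance Definition _ := GRing.Zmodule.on qspace.
HB.instance Definition _ := ZmodQuotient.on qspace.

Lemma qspaceP (u v : V) : (\pi_qspace u = \pi_qspace v) <-> A (u - v).
Proof.
split=> [/eqP|Auv].
  by rewrite -Quotient.idealrBE => /set_mem.
by apply/eqP; rewrite -Quotient.idealrBE; apply/mem_set.
Qed.

Definition qscale (a : F) (q : qspace) : qspace := \pi_qspace (a *: repr q).

Lemma qscale_pi a v : qscale a (\pi v) = \pi_qspace (a *: v).
Proof.
apply/qspaceP; rewrite -scalerBr -[a *: _]addr0.
have [A0 Alin] := (subspaceP A).1 sA.
by apply: Alin => //; apply/qspaceP; rewrite reprK.
Qed.

Lemma qscaleA a b q : qscale a (qscale b q) = qscale (a * b) q.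
Proof. by rewrite -[q]reprK !qscale_pi scalerA. Qed.
Lemma qscale1 : left_id 1 qscale.
Proof. by move=> q; rewrite -[q]reprK qscale_pi scale1r. Qed.
Lemma qscaleDr : right_distributive qscale +%R.
Proof.
move=> a p q; rewrite -[p]reprK -[q]reprK -raddfD !qscale_pi.
by rewrite -raddfD scalerDr.
Qed.
Lemma qscaleDl q : {morph qscale^~ q : a b / a + b}.
Proof.
by move=> a b; rewrite -[q]reprK !qscale_pi -raddfD scalerDl.
Qed.

HB.instance Definition _ :=
  GRing.Zmodule_isLmodule.Build F qspace qscaleA qscale1 qscaleDr qscaleDl.

Lemma qspace_pi_linear : linear \pi_qspace.
Proof. by move=> a u v; rewrite raddfD /= -qscale_pi. Qed.

End QuotientSpace.

Section TensorProduct.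
Variables (F : fieldType) (M N : lmodType F).

Local Notation free := {freeg (M * N)%type / F}.
Local Notation gen m n := (<< (m, n) >> : free).

Definition tensor_relations : set free :=
  [set r | exists a m m' n,
     r = gen (a *: m + m') n - (a *: gen m n + gen m' n)] `|`
  [set r | exists a m n n',
     r = gen m (a *: n + n') - (a *: gen m n + gen m n')].

Definition tensor := qspace (linspan_subspace tensor_relations).
HB.instance Definition _ := GRing.Lmodule.on tensor.

Definition tens (m : M) (n : N) : tensor := \pi_tensor (gen m n).

Lemma tens_bilinear : is_bilinear tens.
Proof.
split=> [n a m m'|m a n n'] /=; rewrite /tens -qspace_pi_linear;
  apply/qspaceP; apply: sub_gen_smallest.
  by left; exists a, m, m', n.
by right; exists a, m, n, n'.
Qed.

Section Lift.
Variables (W : lmodType F) (f : M -> N -> W).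

Definition flift (z : free) : W := fglift (fun p => f p.1 p.2) z.

HB.instance Definition _ :=
  GRing.isZmodMorphism.Build free W flift (lift_is_additive _).

Definition tensor_lift (t : tensor) : W := flift (repr t).

Lemma flift_gen m n : flift (gen m n) = f m n.
Proof. by rewrite /flift liftU scale1r. Qed.

Lemma flift_linear : linear flift.
Proof.
move=> a z z'; rewrite raddfD /=; congr (_ + _).
rewrite -[in RHS](freeg_sumE z) [in RHS]raddf_sum scaler_sumr.
rewrite [in LHS]/GRing.scale /= /fgscale raddf_sum.
by apply: eq_bigr => p _; rewrite /= /flift !liftU scalerA.
Qed.

Hypothesis f_bilinear : is_bilinear f.

Lemma flift_relations (z : free) : linspan tensor_relations z -> flift z = 0.
Proof.
have fl := flift_linear.
apply: (smallest_sub (X := [set z | flift z = 0])).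
  apply/subspaceP; split=> [|a u v /= u0 v0]; first exact: raddf0.
  by rewrite fl u0 v0 scaler0 addr0.
move=> _ [] [a [m [? [n ->]]]] /=; rewrite raddfB /= fl !flift_gen.
  by rewrite f_bilinear.1 subrr.
by rewrite f_bilinear.2 subrr.
Qed.

Lemma tensor_lift_pi (z : free) : tensor_lift (\pi_tensor z) = flift z.
Proof.
apply/eqP; rewrite -subr_eq0 -raddfB.
by apply/eqP/flift_relations/(qspaceP (linspan_subspace _)); rewrite reprK.
Qed.

Lemma tensor_lift_linear : linear tensor_lift.
Proof.
move=> a s t; rewrite -[s]reprK -[t]reprK -qspace_pi_linear.
by rewrite !tensor_lift_pi flift_linear.
Qed.

Lemma tensor_lift_tens m n : tensor_lift (tens m n) = f m n.
Proof. by rewrite tensor_lift_pi flift_gen. Qed.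

End Lift.

Lemma tensor_ind (P : tensor -> Prop) :
  P 0 -> (forall a m n t, P t -> P (a *: tens m n + t)) -> forall t, P t.
Proof.
move=> P0 PS t; rewrite -[t]reprK -(freeg_sumE (repr t)).
elim: (dom _) => [|[m n] s IH]; first by rewrite big_nil raddf0.
rewrite big_cons.
have -> : << coeff (m, n) (repr t) *g (m, n) >> =
    coeff (m, n) (repr t) *: gen m n :> free.
  apply/eqP/freeg_eqP => p.
  by rewrite coeffZ !coeffU mul1r.
by rewrite qspace_pi_linear; apply: PS.
Qed.

End TensorProduct.

Section TensorActions.
Variables (F : fieldType) (L : leibnizType F) (M N : biactType L).
Local Notation MN := (tensor M N).

Definition tensor_lact (x : L) : MN -> MN :=
  tensor_lift (fun m n => tens (lact x m) n + tens m (lact x n)).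

Definition tensor_ract (t : MN) (x : L) : MN :=
  tensor_lift (fun m n => tens (ract m x) n + tens m (ract n x)) t.

Lemma tensor_derivation_bilinear (f : M -> M) (g : N -> N) :
  linear f -> linear g ->
  is_bilinear (fun m n => tens (f m) n + tens m (g n) : MN).
Proof.
have [tl tr] := tens_bilinear M N.
move=> fl gl; split=> [n a m m'|m a n n'] /=.
  by rewrite fl !tl scalerDr addrACA.
by rewrite gl !tr scalerDr addrACA.
Qed.

Let lact_der (x : L) := tensor_derivation_bilinear
  ((@lact_bilinear _ _ M).2 x) ((@lact_bilinear _ _ N).2 x).
Let ract_der (x : L) := tensor_derivation_bilinear
  ((@ract_bilinear _ _ M).1 x) ((@ract_bilinear _ _ N).1 x).

Lemma tensor_lact_tens x m n :
  tensor_lact x (tens m n) = tens (lact x m) n + tens m (lact x n).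
Proof. exact: (tensor_lift_tens (lact_der x)). Qed.

Lemma tensor_ract_tens x m n :
  tensor_ract (tens m n) x = tens (ract m x) n + tens m (ract n x).
Proof. exact: (tensor_lift_tens (ract_der x)). Qed.

Lemma tensor_lact_bilinear : is_bilinear tensor_lact.
Proof.
have lin x : linear (tensor_lact x) := tensor_lift_linear (lact_der x).
split=> [t a x y|x] /=; last exact: lin.
elim/tensor_ind: t => [|b m n t IH].
  have l0 z : tensor_lact z 0 = 0.
    by rewrite -[in LHS](subrr 0) addrC -scaleN1r lin scaleN1r addNr.
  by rewrite !l0 scaler0 addr0.
rewrite !lin IH !tensor_lact_tens !(@lact_bilinear _ _ _).1.
rewrite (tens_bilinear M N).1 (tens_bilinear M N).2.
by rewrite [X in b *: X]addrACA scalerDr addrACA !scalerDr !scalerA [b * a]mulrC.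
Qed.

Lemma tensor_ract_bilinear : is_bilinear tensor_ract.
Proof.
have lin x : linear (tensor_ract^~ x) := tensor_lift_linear (ract_der x).
split=> [x|t a x y] /=; first exact: lin.
elim/tensor_ind: t => [|b m n t IH].
  have l0 z : tensor_ract 0 z = 0.
    by rewrite -[in LHS](subrr 0) addrC -scaleN1r lin scaleN1r addNr.
  by rewrite !l0 scaler0 addr0.
rewrite !lin IH !tensor_ract_tens !(@ract_bilinear _ _ _).2.
rewrite (tens_bilinear M N).1 (tens_bilinear M N).2.
by rewrite [X in b *: X]addrACA scalerDr addrACA !scalerDr !scalerA [b * a]mulrC.
Qed.

HB.instance Definition _ :=
  hasBiaction.Build F L MN tensor_lact_bilinear tensor_ract_bilinear.

End TensorActions.

Section StableSubspaces.
Variables (F : fieldType) (L : leibnizType F) (U : biactType L).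

Definition stable_subspace (A : set U) : Prop :=
  [/\ subspace A,
      forall (x : L) u, A u -> A (lact x u) &
      forall (x : L) u, A u -> A (ract u x)].

Lemma stable_subspace_subspace (A : set U) : stable_subspace A -> subspace A.
Proof. by case. Qed.

Lemma smallest_stable (G : set U) : stable_subspace (smallest stable_subspace G).
Proof.
split; first apply/subspaceP.
- split=> [A [[/subspaceP[]]] //|a u v Gu Gv A AG].
  have [[/subspaceP[_ Alin] _ _] _] := AG.
  by apply: Alin; [apply: Gu|apply: Gv].
- by move=> x u Gu A AG; have [[_ Al _] _] := AG; apply: Al; apply: Gu.
- by move=> x u Gu A AG; have [[_ _ Ar] _] := AG; apply: Ar; apply: Gu.
Qed.

Lemma linspan_stable (G : set U) :
  (forall (x : L) u, G u -> linspan G (lact x u)) ->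
  (forall (x : L) u, G u -> linspan G (ract u x)) ->
  stable_subspace (linspan G).
Proof.
have preim (f : U -> U) : linear f -> (forall u, G u -> linspan G (f u)) ->
    forall u, linspan G u -> linspan G (f u).
  move=> fl Gf; apply: (smallest_sub (X := [set u | linspan G (f u)])) => //.
  have [S0 Sl] := (subspaceP _).1 (linspan_subspace G).
  apply/subspaceP; split=> [|a u v /= Su Sv]; last by rewrite fl; apply: Sl.
  by have /= := fl (-1) 0 0; rewrite !scaler0 addr0 scaleN1r addNr => ->.
move=> Gl Gr; split; first exact: linspan_subspace.
  by move=> x; apply: preim (Gl x); apply: lact_bilinear.2.
by move=> x; apply: (preim (ract^~ x)) (Gr x); apply: ract_bilinear.1.
Qed.

Lemma sum_subspace_stable (A B : set U) :
  stable_subspace A -> stable_subspace B -> stable_subspace (sum_subspace A B).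
Proof.
move=> [sA Al Ar] [sB Bl Br]; split; first exact: sum_subspace_subspace.
  move=> x _ [u Au [v Bv <-]]; exists (lact x u); first exact: Al.
  exists (lact x v); first exact: Bl.
  by have := (@lact_bilinear _ _ U).2 x 1 u v; rewrite /= !scale1r => ->.
move=> x _ [u Au [v Bv <-]]; exists (ract u x); first exact: Ar.
exists (ract v x); first exact: Br.
by have := (@ract_bilinear _ _ U).1 x 1 u v; rewrite /= !scale1r => ->.
Qed.

End StableSubspaces.

Section QuotientActions.
Variables (F : fieldType) (L : leibnizType F) (U : biactType L).
Variables (A : set U) (sA : stable_subspace A).

Definition qbiact := qspace (stable_subspace_subspace sA).
HB.instance Definition _ := EqQuotient.on qbiact.
HB.instance Definition _ := GRing.Lmodule.on qbiact.

Local Notation "[ u ]" := (\pi_qbiact u : qbiact) (at level 0).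

Definition qlact (x : L) (q : qbiact) : qbiact := [lact x (repr q)].
Definition qract (q : qbiact) (x : L) : qbiact := [ract (repr q) x].

Let liftP (f : U -> U) (u : U) :
  linear f -> (forall v, A v -> A (f v)) -> [f (repr [u])] = [f u].
Proof.
move=> fl fA; apply/(qspaceP (stable_subspace_subspace sA)).
rewrite addrC -scaleN1r -fl; apply: fA; rewrite scaleN1r addrC.
by apply/(qspaceP (stable_subspace_subspace sA)); rewrite reprK.
Qed.

Lemma qlact_pi x u : qlact x [u] = [lact x u].
Proof. by case: sA => _ Al _; apply: liftP; [apply: lact_bilinear.2|apply: Al]. Qed.

Lemma qract_pi u x : qract [u] x = [ract u x].
Proof.
by case: sA => _ _ Ar; apply: (@liftP (ract^~ x)); [apply: ract_bilinear.1|apply: Ar].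
Qed.

Lemma qlact_bilinear : is_bilinear qlact.
Proof.
have pl := qspace_pi_linear (stable_subspace_subspace sA).
split=> [q a x y|x a q q'] /=.
  by rewrite -[q]reprK !qlact_pi (@lact_bilinear _ _ _).1 pl.
by rewrite -[q]reprK -[q']reprK -pl !qlact_pi (@lact_bilinear _ _ _).2 pl.
Qed.

Lemma qract_bilinear : is_bilinear qract.
Proof.
have pl := qspace_pi_linear (stable_subspace_subspace sA).
split=> [x a q q'|q a x y] /=.
  by rewrite -[q]reprK -[q']reprK -pl !qract_pi (@ract_bilinear _ _ _).1 pl.
by rewrite -[q]reprK !qract_pi (@ract_bilinear _ _ _).2 pl.
Qed.

HB.instance Definition _ :=
  hasBiaction.Build F L qbiact qlact_bilinear qract_bilinear.

End QuotientActions.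

Definition biact_hom (F : fieldType) (L : leibnizType F) (U V : biactType L)
    (f : U -> V) : Prop :=
  [/\ linear f,
      forall (x : L) u, f (lact x u) = lact x (f u) &
      forall (x : L) u, f (ract u x) = ract (f u) x].

Section QuotientObjects.
Variables (F : fieldType) (L : leibnizType F) (U : biactType L).

Record quotient_of := QuotientOf {
  quot_obj :> biactType L;
  quot_proj : U -> quot_obj;
  quot_proj_hom : biact_hom quot_proj;
  quot_proj_surj : forall q, exists u, quot_proj u = q
}.

(* Equality of quotients of U, identified as usual along the projections from
   U: the (necessarily unique) map under U between them is an isomorphism
   respecting both actions. *)
Definition quot_eq (P Q : quotient_of) : Prop :=
  exists f : P -> Q,
    [/\ biact_hom f, bijective f & forall u, f (quot_proj P u) = quot_proj Q u].

Lemma id_biact_hom : biact_hom (@id U).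
Proof. by split. Qed.

Definition itself : quotient_of :=
  QuotientOf id_biact_hom (fun q => ex_intro _ q erefl).

Section Modulo.
Variables (A : set U) (sA : stable_subspace A).

Lemma pi_biact_hom : biact_hom (\pi_(qbiact sA) : U -> qbiact sA).
Proof.
split=> [|x u|x u]; first exact: qspace_pi_linear.
  by rewrite -qlact_pi.
by rewrite -qract_pi.
Qed.

Lemma pi_surj (q : qbiact sA) : exists u, \pi_(qbiact sA) u = q.
Proof. by exists (repr q); exact: reprK. Qed.

Definition modulo : quotient_of := QuotientOf pi_biact_hom pi_surj.

End Modulo.
End QuotientObjects.

Section LeibnizTensor.
Variables (F : fieldType) (L : leibnizType F).

Definition M_0 (M : bimodType L) : set M :=
  linspan [set v | exists (x : L) (m : M), v = lact x m + ract m x].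

Definition ML (M : bimodType L) : set M :=
  linspan [set v | exists (m : M) (x : L), v = ract m x].

Definition LM (M : bimodType L) : set M :=
  linspan [set v | exists (x : L) (m : M), v = lact x m].

Arguments M_0 M _ : clear implicits.
Arguments ML M _ : clear implicits.
Arguments LM M _ : clear implicits.

Variables M N : bimodType L.
Local Notation MN := (tensor M N).

(* The image of A (x) B in M (x) N, for subspaces A of M and B of N. *)
Definition tensor_subspace (A : set M) (B : set N) : set MN :=
  linspan [set tens m n | m in A & n in B].

Definition S_set : set MN :=
  [set t | exists (x y : L) (m : M) (n : N),
    t = tens (lact x m + ract m x) (ract n y) +
        tens (ract m y) (lact x n + ract n x)].

Definition T_sub : set MN := smallest (@stable_subspace F L MN) S_set.

Definition T0_sub : set MN :=
  sum_subspace (tensor_subspace (M_0 M) (ML N)) (tensor_subspace (ML M) (M_0 N)).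

Lemma T_sub_stable : stable_subspace T_sub.
Proof. exact: smallest_stable. Qed.

Lemma tensor_subspace_stable (A : set M) (B : set N) :
  stable_subspace A -> stable_subspace B -> stable_subspace (tensor_subspace A B).
Proof.
move=> [_ Al Ar] [_ Bl Br].
have [_ Sl] := (subspaceP _).1 (linspan_subspace [set tens m n | m in A & n in B]).
have Sg m n : A m -> B n -> tensor_subspace A B (tens m n).
  by move=> Am Bn; apply: sub_gen_smallest; exists m => //; exists n.
have SD s t : tensor_subspace A B s -> tensor_subspace A B t ->
    tensor_subspace A B (s + t).
  by move=> As At; rewrite -[s]scale1r; apply: Sl.
apply: linspan_stable => x _ [m Am [n Bn <-]].
  have -> : lact x (tens m n) = tens (lact x m) n + tens m (lact x n).
    exact: tensor_lact_tens.
  by apply: SD; apply: Sg => //; [apply: Al|apply: Bl].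
have -> : ract (tens m n) x = tens (ract m x) n + tens m (ract n x).
  exact: tensor_ract_tens.
by apply: SD; apply: Sg => //; [apply: Ar|apply: Br].
Qed.

End LeibnizTensor.

Arguments M_0 {F L} M _.
Arguments ML {F L} M _.
Arguments LM {F L} M _.
Arguments S_set {F L} M N _.
Arguments T_sub {F L} M N _.
Arguments T0_sub {F L} M N _.

Section T0Stable.
Variables (F : fieldType) (L : leibnizType F).

Lemma linspanD (V : lmodType F) (G : set V) u v :
  linspan G u -> linspan G v -> linspan G (u + v).
Proof.
have [_ Sl] := (subspaceP _).1 (linspan_subspace G).
by move=> Gu Gv; rewrite -[u]scale1r; apply: Sl.
Qed.

Lemma M_0_stable (M : bimodType L) : stable_subspace (M_0 M).
Proof.
apply: linspan_stable => y _ [x [m ->]].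
  have -> : lact y (lact x m + ract m x) =
      (lact (lmul y x) m + ract m (lmul y x)) +
      (lact x (lact y m) + ract (lact y m) x).
    have := (@lact_bilinear _ _ M).2 y 1 (lact x m) (ract m x).
    rewrite /= !scale1r => ->; rewrite LLM LML addrACA subrK; congr (_ + _).
    by rewrite [RHS]addrC subrK.
  apply: linspanD; apply: sub_gen_smallest; first by exists (lmul y x), m.
  by exists x, (lact y m).
have -> : ract (lact x m + ract m x) y = 0.
  have := (@ract_bilinear _ _ M).1 y 1 (lact x m) (ract m x).
  by rewrite /= !scale1r => ->; rewrite LML MLL addrA subrK subrr.
by have [] := (subspaceP _).1 (linspan_subspace
  [set v | exists (x : L) (m : M), v = lact x m + ract m x]).
Qed.

Lemma ML_stable (M : bimodType L) : stable_subspace (ML M).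
Proof.
apply: linspan_stable => y _ [m [x ->]].
  have -> : lact y (ract m x) = ract (lact y m) x + ract m (lmul y x).
    by rewrite LML subrK.
  apply: linspanD; apply: sub_gen_smallest; first by exists (lact y m), x.
  by exists m, (lmul y x).
by apply: sub_gen_smallest; exists (ract m x), y.
Qed.

Lemma T0_sub_stable (M N : bimodType L) : stable_subspace (T0_sub M N).
Proof.
by apply: sum_subspace_stable; apply: tensor_subspace_stable;
  (apply: M_0_stable || apply: ML_stable).
Qed.

End T0Stable.

Section TensorQuotients.
Variables (F : fieldType) (L : leibnizType F) (M N : bimodType L).

Definition overtensor : quotient_of (tensor M N) := modulo (T_sub_stable M N).

Definition undertensor : quotient_of (tensor M N) := modulo (T0_sub_stable M N).

End TensorQuotients.

(* Main.v *)
Require Import Defs.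
From mathcomp Require Import all_boot all_algebra boolp classical_sets.
From mathcomp Require Import generic_quotient.

(** If [M] is symmetric then [M_0 = 0], and if [M] is anti-symmetric then
    [ML = 0].  Either way one of the two summands of [T_0(M,N)] vanishes, and so
    does the corresponding summand of every element of [S(M,N)]; what is left of
    [S(M,N)] consists of the pure tensors spanning the other summand of
    [T_0(M,N)].  Hence [T(M,N) = T_0(M,N)], and the four cases follow by
    computing [M_0] and [ML] in terms of [LM]. *)

Set Implicit Arguments.
Unset Strict Implicit.
Unset Printing Implicit Defensive.

Import GRing.Theory.
Local Open Scope ring_scope.
Local Open Scope classical_set_scope.

(** * Spans and sums of subspaces *)

Section Subspaces.
Variables (F : fieldType) (V : lmodType F).
Implicit Types A G : set V.

Lemma subspace_set0 : subspace [set 0 : V].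
Proof. by apply/subspaceP; split=> // a u v -> ->; rewrite scaler0 addr0. Qed.

Lemma linspan_sub A G : subspace A -> G `<=` A -> linspan G `<=` A.
Proof. exact: smallest_sub. Qed.

Lemma linspan_set0 G : G `<=` [set 0] -> linspan G = [set 0].
Proof.
move=> G0; apply/seteqP; split; first exact: linspan_sub subspace_set0 G0.
by move=> _ ->; have [] := (subspaceP _).1 (linspan_subspace G).
Qed.

(** Subspaces are closed under negation. This absorbs the sign in [ract m x = - lact x m] when [ML]
    is compared with [LM]. *)
Lemma linspan_oppr G : linspan (-%R @` G) = linspan G.
Proof.
have opp A v : subspace A -> A v -> A (- v).
  by move=> /subspaceP[A0 Al] Av; rewrite -scaleN1r -[_ *: v]addr0; exact: Al.
apply/seteqP; split; apply: linspan_sub; try exact: linspan_subspace.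
  move=> _ [v Gv <-]; apply: (opp (linspan G)); first exact: linspan_subspace.
  exact: sub_gen_smallest.
move=> v Gv; rewrite -[v]opprK; apply: (opp (linspan _)); first exact: linspan_subspace.
by apply: sub_gen_smallest; exists v.
Qed.

Lemma subspace_preimage (W : lmodType F) (f : V -> W) (A : set W) :
  linear f -> subspace A -> subspace (f @^-1` A).
Proof.
move=> fl /subspaceP[A0 Al]; apply/subspaceP; split=> [|a u v /= Au Av].
  (* Linearity at scalar [-1] and zero vectors yields [f 0 = 0]. *)
  by have /= := fl (-1) 0 0; rewrite !scaler0 addr0 scaleN1r addNr => ->.
by rewrite fl; exact: Al.
Qed.

Lemma sum_subspace0 A : sum_subspace A [set 0] = A.
Proof.
apply/seteqP; split=> [_ [u Au [_ -> <-]]|u Au]; first by rewrite addr0.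
by exists u => //; exists 0; rewrite ?addr0.
Qed.

Lemma sum_0subspace A : sum_subspace [set 0] A = A.
Proof.
apply/seteqP; split=> [_ [_ -> [u Au <-]]|u Au]; first by rewrite add0r.
by exists 0 => //; exists u; rewrite ?add0r.
Qed.

End Subspaces.

(** * Pure tensors and the subspaces they span *)

Section Tensors.
Variables (F : fieldType) (M N : lmodType F).

Lemma tens_linearl (n : N) : linear (fun m : M => tens m n).
Proof. exact: (tens_bilinear M N).1. Qed.

Lemma tens_linearr (m : M) : linear (fun n : N => tens m n).
Proof. exact: (tens_bilinear M N).2. Qed.

Lemma tens0l (n : N) : tens (0 : M) n = 0.
Proof.
by have := tens_linearl n (-1) 0 0; rewrite !scaler0 addr0 scaleN1r addNr.
Qed.

Lemma tens0r (m : M) : tens m (0 : N) = 0.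
Proof.
by have := tens_linearr m (-1) 0 0; rewrite !scaler0 addr0 scaleN1r addNr.
Qed.

End Tensors.

Section TensorSubspaces.
Variables (F : fieldType) (L : leibnizType F) (M N : bimodType L).

(** Bilinearity lets one argument be extended at a time: first from [G] to its span with the right
    factor in [H], then from [H] to its span with the left factor fixed. Each time the preimage of
    [A] under a partial map of [tens] is a subspace. *)
Lemma tensor_subspace_linspan_sub (G : set M) (H : set N)
    (A : set (tensor M N)) :
  subspace A -> (forall m n, G m -> H n -> A (tens m n)) ->
  tensor_subspace (linspan G) (linspan H) `<=` A.
Proof.
move=> sA GHA; apply: linspan_sub => // _ [m Gm [n Hn <-]].
have GA n' : H n' -> A (tens m n').
  move=> Hn'.
  apply: (linspan_sub (subspace_preimage (tens_linearl n') sA)) Gm => m' Gm'.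
  exact: GHA.
exact: (linspan_sub (subspace_preimage (tens_linearr m) sA)) Hn.
Qed.

Lemma tensor_subspace0l (B : set N) :
  tensor_subspace [set 0 : M] B = [set 0].
Proof. by apply: linspan_set0 => _ [_ -> [n _ <-]]; exact: tens0l. Qed.

Lemma tensor_subspace0r (A : set M) :
  tensor_subspace A [set 0 : N] = [set 0].
Proof. by apply: linspan_set0 => _ [m _ [_ -> <-]]; exact: tens0r. Qed.

End TensorSubspaces.

(** * Comparison of [T_sub] with [T0_sub] *)

Section Bimodules.
Variables (F : fieldType) (L : leibnizType F).

Lemma M_0_symmetric (M : bimodType L) : symmetric_bimod M -> M_0 M = [set 0].
Proof.
by move=> sM; apply: linspan_set0 => _ [x [m ->]]; rewrite sM subrr.
Qed.

Lemma ML_symmetric (M : bimodType L) : symmetric_bimod M -> ML M = LM M.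
Proof.
move=> sM; rewrite /LM -linspan_oppr; congr linspan; apply/seteqP; split.
  by move=> _ [m [x ->]]; rewrite sM; exists (lact x m) => //; exists x, m.
by move=> _ [_ [x [m ->]] <-]; exists m, x; rewrite sM.
Qed.

Lemma M_0_antisymmetric (M : bimodType L) :
  antisymmetric_bimod M -> M_0 M = LM M.
Proof.
move=> aM; congr linspan; apply/seteqP.
by split=> _ [x [m ->]]; exists x, m; rewrite aM addr0.
Qed.

Lemma ML_antisymmetric (M : bimodType L) :
  antisymmetric_bimod M -> ML M = [set 0].
Proof. by move=> aM; apply: linspan_set0 => _ [m [x ->]]; rewrite aM. Qed.

Variables M N : bimodType L.

(** [T0_sub] is stable, and the two terms of an element of [S_set] are spanning tensors of its two
    summands. *)
Lemma T_sub_sub_T0 : T_sub M N `<=` T0_sub M N.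
Proof.
apply: smallest_sub; first exact: T0_sub_stable.
move=> _ [x [y [m [n ->]]]].
exists (tens (lact x m + ract m x) (ract n y)).
  apply: sub_gen_smallest; exists (lact x m + ract m x).
    by apply: sub_gen_smallest; exists x, m.
  by exists (ract n y) => //; apply: sub_gen_smallest; exists n, y.
exists (tens (ract m y) (lact x n + ract n x)) => //.
apply: sub_gen_smallest; exists (ract m y).
  by apply: sub_gen_smallest; exists m, y.
by exists (lact x n + ract n x) => //; apply: sub_gen_smallest; exists x, n.
Qed.

(** Nothing is asked of [N], so this serves both (a) and (c); the anti-symmetric version likewise
    serves (b) and (d). *)
Lemma T_sub_symmetricl : symmetric_bimod M -> T_sub M N = T0_sub M N.
Proof.
move=> sM; apply/seteqP; split; first exact: T_sub_sub_T0.
rewrite /T0_sub (M_0_symmetric sM) tensor_subspace0l sum_0subspace.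
apply: tensor_subspace_linspan_sub.
  exact: stable_subspace_subspace (T_sub_stable M N).
move=> _ _ [m [y ->]] [x [n ->]]; apply: sub_gen_smallest.
by exists x, y, m, n; rewrite (sM x m) subrr tens0l add0r.
Qed.

Lemma T_sub_antisymmetricl : antisymmetric_bimod M -> T_sub M N = T0_sub M N.
Proof.
move=> aM; apply/seteqP; split; first exact: T_sub_sub_T0.
rewrite /T0_sub (ML_antisymmetric aM) tensor_subspace0l sum_subspace0.
apply: tensor_subspace_linspan_sub.
  exact: stable_subspace_subspace (T_sub_stable M N).
move=> _ _ [x [m ->]] [n [y ->]]; apply: sub_gen_smallest.
by exists x, y, m, n; rewrite (aM y m) tens0l addr0.
Qed.

End Bimodules.

(** * Equality of quotients *)

Section Quotients.
Variables (F : fieldType) (L : leibnizType F) (U : biactType L).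

Lemma quot_eq_modulo (A B : set U) (sA : stable_subspace A)
    (sB : stable_subspace B) : A = B -> quot_eq (modulo sA) (modulo sB).
Proof.
(* The quotient types also depend on the stability proofs; once these are identified, the identity
   map is the isomorphism. *)
move=> AB; subst B; rewrite (Prop_irrelevance sB sA).
by exists id; split=> //; exists id.
Qed.

(** Modulo zero a class has a single element, so [repr] is a two-sided inverse of the projection and
    inherits its compatibility with the operations. *)
Lemma quot_eq_modulo0 (A : set U) (sA : stable_subspace A) :
  A = [set 0] -> quot_eq (modulo sA) (itself U).
Proof.
move=> A0; have [pl pL pR] := pi_biact_hom sA.
have reprK0 u : repr (\pi_(qbiact sA)%qT u) = u.
  have A_eq0 v : A v -> v = 0 by rewrite A0.
  apply/eqP; rewrite -subr_eq0; apply/eqP/A_eq0.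
  by apply/(qspaceP (stable_subspace_subspace sA)); rewrite reprK.
exists (fun q : qbiact sA => repr q); split=> //.
  split=> [a p q|x q|x q].
  - by rewrite -[p]reprK -[q]reprK -pl !reprK0.
  - by rewrite -[q]reprK -pL !reprK0.
  - by rewrite -[q]reprK -pR !reprK0.
by exists \pi_(qbiact sA)%qT => [q|u]; [exact: reprK|exact: reprK0].
Qed.

End Quotients.

Theorem corollary4p7 (F : fieldType) (L : leibnizType F) (M N : bimodType L) :
  [/\ (symmetric_bimod M -> symmetric_bimod N ->
        quot_eq (overtensor M N) (undertensor M N) /\
        quot_eq (undertensor M N) (itself (tensor M N))),
      (antisymmetric_bimod M -> antisymmetric_bimod N ->
        quot_eq (overtensor M N) (undertensor M N) /\
        quot_eq (undertensor M N) (itself (tensor M N))),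
      (symmetric_bimod M -> antisymmetric_bimod N ->
        quot_eq (overtensor M N) (undertensor M N) /\
        exists sLL : stable_subspace (tensor_subspace (LM M) (LM N)),
          quot_eq (undertensor M N) (modulo sLL)) &
      (antisymmetric_bimod M -> symmetric_bimod N ->
        quot_eq (overtensor M N) (undertensor M N) /\
        exists sLL : stable_subspace (tensor_subspace (LM M) (LM N)),
          quot_eq (undertensor M N) (modulo sLL))].
Proof.
have LL : T0_sub M N = tensor_subspace (LM M) (LM N) ->
    exists sLL : stable_subspace (tensor_subspace (LM M) (LM N)),
      quot_eq (undertensor M N) (modulo sLL).
  (* Stability of [LM M] tensor [LM N] is transported from [T0_sub] along the equality. *)
  move=> T0E; have sLL := T0_sub_stable M N; rewrite T0E in sLL.
  by exists sLL; exact: quot_eq_modulo.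
split=> hM hN; split.
- exact/quot_eq_modulo/T_sub_symmetricl.
(* Each summand of [T0_sub] has a zero factor: [M_0 M] in the first, [M_0 N] in the second. *)
- apply: quot_eq_modulo0; rewrite /T0_sub !M_0_symmetric //.
  by rewrite tensor_subspace0l tensor_subspace0r sum_subspace0.
- exact/quot_eq_modulo/T_sub_antisymmetricl.
- apply: quot_eq_modulo0; rewrite /T0_sub !ML_antisymmetric //.
  by rewrite tensor_subspace0l tensor_subspace0r sum_subspace0.
- exact/quot_eq_modulo/T_sub_symmetricl.
(* Here the second summand of [T0_sub] survives; in (d) it is the first. *)
- apply: LL; rewrite /T0_sub (M_0_symmetric hM) (ML_symmetric hM).
  by rewrite (M_0_antisymmetric hN) tensor_subspace0l sum_0subspace.
- exact/quot_eq_modulo/T_sub_antisymmetricl.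
- apply: LL; rewrite /T0_sub (M_0_antisymmetric hM) (ML_antisymmetric hM).
  by rewrite (ML_symmetric hN) tensor_subspace0l sum_subspace0.
Qed.
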